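(* Let $\tau \ge 0$, let $\mathbf{y} \in \mathbb{R}^n$ have all entries nonzero, and suppose that the entries of $\mathbf{y}$ are arranged as $y_1^2 \geq \cdots \geq y_n^2$. Let $f(\mathbf{y}) = \sqrt{n}\, \mathbf{y} / \|\mathbf{y}\|_2$ be RMS layer normalization, and let $\mathbf{q} \in \{0,1\}^n$ be a solution of the componentwise LAMP problem for $f$ at $\mathbf{y}$ with threshold $\tau$, i.e. a minimizer of $$\|\mathbf{q}\|_0 \to \min \quad \text{subject to} \quad \mathbf{q} \in \{0,1\}^n,\ \kappa_c(f,\mathbf{y};\mathbf{q}) \leq \tau.$$ If $\|\mathbf{q}\|_0 \leq n-3$, then the vector $\mathbf{q}' \in \{0,1\}^n$ given by $$\mathbf{q}' = (1, \ldots, 1, 0, \ldots, 0)^{\top}, \quad \|\mathbf{q}'\|_0 = \|\mathbf{q}\|_0 + q_n$$ (all ones first, then all zeros) also satisfies $\kappa_c(f, \mathbf{y}; \mathbf{q}') \leq \tau$.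
   Context: For a function $f$ (defined and differentiable near $\mathbf{y} \in \mathbb{R}^n$, with values in $\mathbb{R}^n$) such that all entries of $f(\mathbf{y})$ are nonzero, let $\mathbf{J}_f(\mathbf{y}) \in \mathbb{R}^{n \times n}$ be its Jacobian matrix at $\mathbf{y}$, and set $$\mathbf{M}(f,\mathbf{y}) = \mathrm{diag}(f(\mathbf{y}))^{-1}\, \mathbf{J}_f(\mathbf{y})\, \mathrm{diag}(\mathbf{y}).$$ For $\mathbf{q} \in \{0,1\}^n$ define $$\kappa_c(f,\mathbf{y};\mathbf{q}) = \big\| \mathbf{M}(f,\mathbf{y}) (\mathbf{I} - \mathrm{diag}(\mathbf{q})) \big\|_{\infty,\infty},$$ where $\|\cdot\|_{\infty,\infty}$ is the operator norm from $\ell_\infty$ to $\ell_\infty$, i.e. the maximum absolute row sum, $\mathrm{diag}(\mathbf{v})$ is the diagonal matrix with diagonal $\mathbf{v}$, and $\mathbf{I}$ is the identity matrix. $\|\mathbf{q}\|_0$ denotes the number of nonzero entries of $\mathbf{q}$. *)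

(* Defs.v *)
From HB Require Import structures.
From mathcomp Require Import all_boot all_order all_algebra.
From mathcomp Require Import all_classical all_reals all_analysis.

Set Implicit Arguments.
Unset Strict Implicit.
Unset Printing Implicit Defensive.

Import Order.TTheory GRing.Theory Num.Theory.
Import numFieldNormedType.Exports.

Local Open Scope classical_set_scope.
Local Open Scope ring_scope.

Section Defs.
Variable R : realType.

(* The library's norm on matrices is the entrywise sup norm, so the Euclidean
   norm has to be written out. *)
Definition l2norm n (y : 'rV[R]_n) : R := Num.sqrt (\sum_i y 0 i ^+ 2).

Definition rmsnorm n (y : 'rV[R]_n) : 'rV[R]_n :=
  (Num.sqrt n%:R / l2norm y) *: y.

(* The operator norm from l_oo to l_oo as the maximum absolute row sum; see
   [linf_opnormE]. *)
Definition linf_opnorm m n (A : 'M[R]_(m, n)) : R :=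
  \big[Num.max/0]_i \sum_j `|A i j|.

(* ['J f y] acts on row vectors by right multiplication (its entry (i, j) is
   the i-th partial derivative of the j-th component of f), hence the
   transpose; see [Jacobian_mxE]. *)
Definition Jacobian_mx n (f : 'rV[R]_n -> 'rV[R]_n) (y : 'rV[R]_n) : 'M[R]_n :=
  ('J f y)^T.

Definition cond_mx n (f : 'rV[R]_n -> 'rV[R]_n) (y : 'rV[R]_n) : 'M[R]_n :=
  invmx (diag_mx (f y)) *m Jacobian_mx f y *m diag_mx y.

(* Elements of {0,1}^n are boolean row vectors; this is their image in R^n. *)
Definition mask_row n (q : 'rV[bool]_n) : 'rV[R]_n :=
  \row_i (q 0 i)%:R.

Definition kappa_c n (f : 'rV[R]_n -> 'rV[R]_n) (y : 'rV[R]_n)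
    (q : 'rV[bool]_n) : R :=
  linf_opnorm (cond_mx f y *m (1%:M - diag_mx (mask_row q))).

Definition norm0 n (q : 'rV[bool]_n) : nat := #|[set i | q 0 i]%SET|.

Definition lamp_solution n (f : 'rV[R]_n -> 'rV[R]_n) (y : 'rV[R]_n) (tau : R)
    (q : 'rV[bool]_n) : Prop :=
  kappa_c f y q <= tau /\
  forall p : 'rV[bool]_n, kappa_c f y p <= tau -> (norm0 q <= norm0 p)%N.

Definition leading_ones n (k : nat) : 'rV[bool]_n := \row_i (i < k)%N.

Lemma norm0_leading_ones n k : (k <= n)%N -> norm0 (leading_ones n k) = k.
Proof.
move=> kn; have wI : injective (widen_ord kn).
  by move=> i j /(congr1 val) /= ij; apply: val_inj.
rewrite /norm0 -[RHS]card_ord -(card_imset _ wI).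
apply: eq_card => i; rewrite inE mxE; apply/idP/imsetP => [ik|[j _ ->]].
  by exists (Ordinal ik) => //; apply: val_inj.
by rewrite /= ltn_ord.
Qed.

Lemma Jacobian_mxE n (f : 'rV[R]_n -> 'rV[R]_n) (y : 'rV[R]_n) i j :
  differentiable f y -> Jacobian_mx f y i j = ('D_(delta_mx 0 j) f y) 0 i.
Proof. by move=> df; rewrite deriveEjacobian // -rowE !mxE. Qed.

Lemma linf_opnormE m n (A : 'M[R]_(m, n)) :
  linf_opnorm A = sup [set `|A *m x| | x in [set x : 'cV[R]_n | `|x| <= 1]].
Proof.
have nrm p (x : 'cV[R]_p) i : `|x i 0| <= `|x|.
  rewrite [leRHS]/Num.norm/= mx_normrE.
  exact: (le_bigmax_cond _ (fun ij => `|x ij.1 ij.2|) (j := (i, 0))).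
have nrm_le p (x : 'cV[R]_p) c :
    0 <= c -> (forall i, `|x i 0| <= c) -> `|x| <= c.
  move=> c0 xc; rewrite [leLHS]/Num.norm/= mx_normrE.
  by apply: bigmax_le => // -[i j] _ /=; rewrite ord1.
have op0 : 0 <= linf_opnorm A by exact: bigmax_ge_id.
set S := [set _ | _ in _].
have ubS : ubound S (linf_opnorm A).
  move=> _ [x /= x1 <-]; apply: nrm_le => // i; rewrite mxE.
  apply: le_trans (ler_norm_sum _ _ _) _.
  apply: (@le_trans _ _ (\sum_j `|A i j|)).
    apply: ler_sum => j _; rewrite normrM ler_piMr //.
    exact: le_trans (nrm _ x j) x1.
  exact: (le_bigmax_cond _ (fun i => \sum_j `|A i j|)).
have S0 : S 0.
  by exists 0; rewrite /= ?mulmx0 normr0.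
have hS : has_sup S by split; [exists 0 | exists (linf_opnorm A)].
apply/eqP; rewrite eq_le; apply/andP; split; last first.
  by apply: ge_sup => //; exists 0.
apply: bigmax_le => [|i _]; first exact: (ub_le_sup hS.2 S0).
pose x : 'cV[R]_n := \col_j Num.sg (A i j).
have x1 : `|x| <= 1.
  apply: nrm_le => // j; rewrite mxE normr_sg.
  by case: eqP.
apply: (@le_trans _ _ `|A *m x|); last first.
  by apply: (ub_le_sup hS.2); exists x.
apply: le_trans (nrm _ _ i); rewrite mxE.
apply: le_trans (ler_norm _); apply: ler_sum => j _.
by rewrite mxE mulrC -normrEsg.
Qed.

End Defs.

(* Main.v *)
(* Writing w_j = y_j^2 / ||y||_2^2 (nonnegative weights of sum 1), the matrix
   M(f, y) has entries delta_ij - w_j. If S is the total weight of the indices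
   that q does not mask, its masked row sums are S (i masked) and
   1 + S - 2 w_i (i not masked), the latter being the larger ones as long as
   w_i <= 1/2. For leading ones, the maximum is 1 + S' - 2 w_n.
   If q keeps n, then S' <= S suffices. If q masks n, choose two kept indices
   with w_i <= w_j and exchange both for n: S' <= S - w_i - w_j + w_n, so
   S' - 2 w_n <= S - 2 w_i. *)
Require Import Defs.
From mathcomp Require Import all_boot all_order all_algebra.
From mathcomp Require Import all_classical all_reals all_analysis.
From mathcomp Require Import ring lra zify.

Set Implicit Arguments.
Unset Strict Implicit.
Unset Printing Implicit Defensive.

Import Order.TTheory GRing.Theory Num.Theory.
Import numFieldNormedType.Exports.

Local Open Scope ring_scope.

(** * Derivative of RMS normalization and the entries of its condition matrix *)

Section RmsnormDerivative.
Context {R : realType} {n : nat}.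
Implicit Types y v : 'rV[R]_n.

Lemma l2norm_gt0 y : y != 0 -> 0 < l2norm y.
Proof.
move=> y0; rewrite sqrtr_gt0 lt0r sumr_ge0 ?andbT => [|i _]; last exact: sqr_ge0.
apply: contraNneq y0 => /eqP; rewrite psumr_eq0 => [/allP s0|i _]; last exact: sqr_ge0.
apply/eqP/rowP => i; rewrite mxE; apply/eqP.
by rewrite -sqrf_eq0 (eqP (s0 i (mem_index_enum i))).
Qed.

Lemma sqr_l2norm y : l2norm y ^+ 2 = \sum_i y 0 i ^+ 2.
Proof. by rewrite sqr_sqrtr// sumr_ge0// => i _; exact: sqr_ge0. Qed.

Lemma is_derive_coord (i : 'I_n) y v :
  is_derive y v (fun z : 'rV[R]_n => z 0 i) (v 0 i).
Proof.
have d : derivable (fun z : 'rV[R]_n => z 0 i) y v.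
  exact/diff_derivable/differentiable_coord.
apply: DeriveDef => //.
(* The identity map has derivative [v] in direction [v]; [derive_mx] reads this entry by entry. *)
by have := @derive_mx _ _ _ _ id y v (@derivable_id _ _ y v);
  rewrite derive_id => /(congr1 (fun A : 'rV[R]_n => A 0 i)); rewrite mxE => <-.
Qed.

Lemma differentiable_sumsqr y :
  differentiable (\sum_i (fun z : 'rV[R]_n => z 0 i) ^+ 2) y.
Proof.
by apply: differentiable_sum => i; apply/differentiableX/differentiable_coord.
Qed.

Lemma l2normE : @l2norm R n =
  Num.sqrt \o (\sum_i (fun z : 'rV[R]_n => z 0 i) ^+ 2).
Proof.
by apply/funext => z /=; congr Num.sqrt; rewrite fct_sumE.
Qed.

Lemma sqrt_differentiable (x : R) : 0 < x -> differentiable Num.sqrt x.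
Proof. by move=> x0; apply/derivable1_diffP; have [] := is_derive1_sqrt x0. Qed.

Lemma differentiable_l2norm y : y != 0 -> differentiable (@l2norm R n) y.
Proof.
move=> y0; rewrite l2normE; apply: differentiable_comp.
  exact: differentiable_sumsqr.
apply: sqrt_differentiable; rewrite -sqrtr_gt0.
by have := l2norm_gt0 y0; rewrite l2normE.
Qed.

Lemma derive_l2norm y v : y != 0 ->
  'D_v (@l2norm R n) y = (\sum_i y 0 i * v 0 i) / l2norm y.
Proof.
move=> y0; have ly := l2norm_gt0 y0.
have lyE := congr1 (@^~ y) l2normE; rewrite /= in lyE.
have s0 : 0 < (\sum_i (fun z : 'rV[R]_n => z 0 i) ^+ 2) y by rewrite -sqrtr_gt0 -lyE.
have ds := sqrt_differentiable s0; have dq := differentiable_sumsqr y.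
rewrite deriveE; last exact: differentiable_l2norm.
rewrite l2normE diff_comp// /= deriv1E; last exact/derivable1_diffP.
rewrite derive1E derive_sqrt// -deriveE// derive_sum => [|i]; last first.
  exact/derivableX/diff_derivable/differentiable_coord.
have -> : \sum_(i < n) 'D_v ((fun z : 'rV[R]_n => z 0 i) ^+ 2) y =
    2 * \sum_i y 0 i * v 0 i.
  rewrite mulr_sumr; apply: eq_bigr => i _.
  have ci := is_derive_coord i y v.
  by rewrite deriveX; [rewrite derive_val /GRing.scale/= expr1 mulrA | case: ci].
rewrite -lyE /GRing.scale/=; field; exact: lt0r_neq0.
Qed.

Lemma differentiable_rmsnorm y : y != 0 -> differentiable (@rmsnorm R n) y.
Proof.
move=> y0.
(* Expanding in the standard basis reduces differentiability to scalar functions, each a coordinate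
   divided by the norm. *)
have -> : @rmsnorm R n = \sum_(i < n)
    (fun z => (Num.sqrt n%:R *: ((fun u => (l2norm u)^-1 : R) * (fun u => u 0 i))) z
              *: delta_mx 0 i).
  apply/funext => z; rewrite fct_sumE /rmsnorm {2}[z]row_sum_delta.
  rewrite scaler_sumr; apply: eq_bigr => i _.
  by rewrite scalerA -mulrA.
apply: differentiable_sum => i.
apply: differentiableZl; apply: differentiableZ; apply: differentiableM.
  by apply: differentiableV; [exact: differentiable_l2norm|exact/lt0r_neq0/l2norm_gt0].
exact: differentiable_coord.
Qed.

Lemma derive_rmsnorm y v (i : 'I_n) : y != 0 ->
  ('D_v (@rmsnorm R n) y) 0 i =
  Num.sqrt n%:R / l2norm y * (v 0 i - y 0 i * (\sum_j y 0 j * v 0 j) / l2norm y ^+ 2).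
Proof.
move=> y0; have l0 := lt0r_neq0 (l2norm_gt0 y0).
have dl : derivable (@l2norm R n) y v by exact/diff_derivable/differentiable_l2norm.
rewrite derive_mx; last exact/diff_derivable/differentiable_rmsnorm.
rewrite mxE.
have -> : (fun z => rmsnorm z 0 i) =
    Num.sqrt n%:R *: ((fun u => (l2norm u)^-1 : R) * (fun u => u 0 i)).
  by apply/funext => z; rewrite mxE -mulrA.
have [dc cE] := is_derive_coord i y v.
rewrite deriveZ; last by apply: derivableM => //; exact: derivableV.
rewrite deriveM//; last exact: derivableV.
rewrite cE deriveV// derive_l2norm// /GRing.scale/=; field; exact: l0.
Qed.

(** With s = sqrt n / ||y||, the Jacobian entry is s (delta_ij - y_i y_j / ||y||^2). Dividing row i
    by s y_i and multiplying column j by y_j cancels s and y_i, and delta_ij y_j / y_i is again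
    delta_ij. *)
Lemma cond_mx_rmsnorm y (i j : 'I_n) : (forall k, y 0 k != 0) ->
  cond_mx (@rmsnorm R n) y i j = (i == j)%:R - y 0 j ^+ 2 / l2norm y ^+ 2.
Proof.
move=> yn0.
have y0 : y != 0 by apply: contraNneq (yn0 i) => ->; rewrite mxE.
have l0 := lt0r_neq0 (l2norm_gt0 y0).
have s0 : Num.sqrt n%:R != 0 :> R.
  by rewrite gt_eqF// sqrtr_gt0 ltr0n (leq_ltn_trans _ (ltn_ord i)).
have inv_diag : invmx (diag_mx (rmsnorm y)) = diag_mx (\row_k (rmsnorm y 0 k)^-1).
  have dV : diag_mx (rmsnorm y) *m diag_mx (\row_k (rmsnorm y 0 k)^-1) = 1%:M.
    rewrite mulmx_diag; apply/matrixP => a b; rewrite !mxE.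
    have [->|] := eqVneq a b; last by rewrite !mulr0n.
    by rewrite !mulr1n mulfV// !mulf_neq0 ?invr_eq0.
  have [du _] := mulmx1_unit dV.
  by rewrite -[RHS](mulKmx du) dV mulmx1.
rewrite /cond_mx inv_diag mul_mx_diag mxE mul_diag_mx 2!mxE Jacobian_mxE; last first.
  exact: differentiable_rmsnorm.
rewrite derive_rmsnorm// (bigD1 j)//= big1 => [|k kj]; last first.
  by rewrite mxE (negbTE kj) andbF mulr0.
rewrite !mxE !eqxx/= mulr1 addr0.
have yi := yn0 i; have yj := yn0 j.
by have [->|ij] := eqVneq i j; rewrite /=; field; rewrite ?l0 ?s0 ?yi ?yj.
Qed.

End RmsnormDerivative.

(** As the cardinalities agree, subtracting [c] from every weight shifts both sums equally. The
    shifted terms are then nonpositive on [A] minus [B], nonnegative on [B] minus [A], and shared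
    elsewhere. *)
Lemma ler_sum_card_threshold (R : realDomainType) (T : finType) (w : T -> R)
    (c : R) (A B : {set T}) : #|A| = #|B| ->
  (forall i, i \in A -> i \notin B -> w i <= c) ->
  (forall i, i \in B -> i \notin A -> c <= w i) ->
  \sum_(i in A) w i <= \sum_(i in B) w i.
Proof.
move=> cAB Ac Bc.
suff : \sum_(i in A) (w i - c) <= \sum_(i in B) (w i - c).
  by rewrite !sumrB !sumr_const cAB lerD2r.
rewrite big_mkcond [leRHS]big_mkcond; apply: ler_sum => i _.
have := Ac i; have := Bc i; case: (i \in A); case: (i \in B) => //= Bi Ai.
- by rewrite subr_le0 Ai.
- by rewrite subr_ge0 Bi.
Qed.

(** * The condition number expressed through normalized squared weights *)

Section KappaRmsnorm.
Context {R : realType} {n : nat} (y : 'rV[R]_n).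
Implicit Type q : 'rV[bool]_n.

Definition sq_weight i : R := y 0 i ^+ 2 / l2norm y ^+ 2.
Local Notation w := sq_weight.

Definition kept q : {set 'I_n} := [set i | ~~ q 0 i].

Definition kept_weight q := \sum_(i in kept q) w i.

Lemma norm0_kept q : (norm0 q + #|kept q| = n)%N.
Proof.
rewrite /norm0 -[RHS]card_ord -(cardsC [set i | q 0 i]%SET); congr (_ + _)%N.
by apply: eq_card => i; rewrite !inE.
Qed.

Lemma sq_weight_ge0 i : 0 <= w i.
Proof. by rewrite divr_ge0 ?sqr_ge0. Qed.

Hypothesis y_neq0 : forall i, y 0 i != 0.

Lemma sum_sq_weight : (0 < n)%N -> \sum_i w i = 1.
Proof.
move=> n_gt0; rewrite -mulr_suml -sqr_l2norm mulfV// expf_neq0//.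
rewrite lt0r_neq0// l2norm_gt0//.
by apply: contraNneq (y_neq0 (Ordinal n_gt0)) => ->; rewrite mxE.
Qed.

Lemma sq_weightD_le1 (i j : 'I_n) : i != j -> w i + w j <= 1.
Proof.
move=> ij; rewrite -(sum_sq_weight (leq_ltn_trans (leq0n _) (ltn_ord i))).
rewrite (bigD1 i)//= (bigD1 j) 1?eq_sym//= addrA lerDl.
by apply: sumr_ge0 => k _; exact: sq_weight_ge0.
Qed.

Lemma sq_weight_le1 i : w i <= 1.
Proof.
rewrite -(sum_sq_weight (leq_ltn_trans (leq0n _) (ltn_ord i))) (bigD1 i)//= lerDl.
by apply: sumr_ge0 => k _; exact: sq_weight_ge0.
Qed.

(** In row [i], each kept off-diagonal column [j] contributes [w j]. If [i] itself is kept, the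
    diagonal contributes 1 - w_i, nonnegative since w_i <= 1, instead of w_i. *)
Lemma kappa_c_rmsnorm q : kappa_c (@rmsnorm R n) y q =
  \big[Num.max/0]_i (kept_weight q + (if q 0 i then 0 else 1 - 2 * w i)).
Proof.
apply: eq_bigr => i _.
transitivity (\sum_(j in kept q) `|(i == j)%:R - w j|).
  rewrite [RHS]big_mkcond; apply: eq_bigr => j _.
  move: (cond_mx _ _) (cond_mx_rmsnorm i j y_neq0) => C CE.
  rewrite mulmxBr mulmx1 mul_mx_diag !mxE CE inE.
  by case: (q 0 j); rewrite /= ?mulr1 ?mulr0 ?subrr ?subr0 ?normr0.
rewrite /kept_weight; have off j : i != j -> `|(i == j)%:R - w j| = w j.
  by move=> /negbTE ->; rewrite sub0r normrN ger0_norm ?sq_weight_ge0.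
case: ifP => qi.
  rewrite addr0; apply: eq_bigr => j; rewrite inE => qj; apply: off.
  by apply: contraNneq qj => <-; rewrite qi.
have iZ : i \in kept q by rewrite inE qi.
rewrite (bigD1 i)//= [in RHS](bigD1 i)//= eqxx ger0_norm; last first.
  by rewrite subr_ge0 sq_weight_le1.
have -> : \sum_(j in kept q | j != i) `|(i == j)%:R - w j| =
    \sum_(j in kept q | j != i) w j.
  by apply: eq_bigr => j /andP[_ ji]; rewrite off// eq_sym.
by rewrite /=; ring.
Qed.

Lemma kappa_c_rmsnorm_ge q i : ~~ q 0 i ->
  kept_weight q + 1 - 2 * w i <= kappa_c (@rmsnorm R n) y q.
Proof.
move=> /negbTE qi; rewrite kappa_c_rmsnorm.
have := le_bigmax_cond 0
  (fun i => kept_weight q + (if q 0 i then 0 else 1 - 2 * w i)) (erefl : xpredT i).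
by rewrite qi addrA.
Qed.

(** The second index [i] forces w_m <= 1/2, because 2 w_m <= w_i + w_m <= 1. Hence 1 - 2 w_m is
    nonnegative, and the bound also covers masked rows and the default value 0 of the maximum. *)
Lemma kappa_c_rmsnorm_le q m (i : 'I_n) : i != m -> (forall j, w m <= w j) ->
  kappa_c (@rmsnorm R n) y q <= kept_weight q + 1 - 2 * w m.
Proof.
move=> im wm; have wim := wm i; have := sq_weightD_le1 im => w1.
rewrite kappa_c_rmsnorm; apply: bigmax_le => [|j _].
  have : 0 <= kept_weight q by apply: sumr_ge0 => k _; exact: sq_weight_ge0.
  lra.
by have := wm j; case: ifP => _; lra.
Qed.

Hypothesis y_sorted :
  forall i j : 'I_n, (i <= j)%N -> y 0 j ^+ 2 <= y 0 i ^+ 2.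

Lemma sq_weight_sorted (i j : 'I_n) : (i <= j)%N -> w j <= w i.
Proof. by move=> ij; rewrite ler_wpM2r ?invr_ge0 ?sqr_ge0 ?y_sorted. Qed.

(** The indices kept are the last n - k ones, which carry the smallest weights; w_k is the threshold
    separating them from the masked ones. *)
Lemma kept_weight_leading_ones (k : 'I_n) (A : {set 'I_n}) :
  #|A| = (n - k)%N -> kept_weight (leading_ones n k) <= \sum_(i in A) w i.
Proof.
move=> cA; apply: (@ler_sum_card_threshold _ _ _ (w k)) => [|i|i _].
- apply/eqP; rewrite cA -(eqn_add2l k).
  rewrite -{1}(norm0_leading_ones (ltnW (ltn_ord k))) norm0_kept subnKC//.
  exact: ltnW.
- by rewrite inE mxE -leqNgt => /sq_weight_sorted.
- by rewrite inE mxE negbK => /ltnW /sq_weight_sorted.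
Qed.

End KappaRmsnorm.

Theorem proposition3p2 (R : realType) (n : nat) (tau : R) (y : 'rV[R]_n.+1)
    (q : 'rV[bool]_n.+1)
    (tau_ge0 : 0 <= tau)
    (y_neq0 : forall i, y 0 i != 0)
    (y_sorted : forall i j : 'I_n.+1, (i <= j)%N -> y 0 j ^+ 2 <= y 0 i ^+ 2)
    (q_sol : lamp_solution (@rmsnorm R n.+1) y tau q)
    (q_small : (norm0 q + 3 <= n.+1)%N) :
  kappa_c (@rmsnorm R n.+1) y (leading_ones n.+1 (norm0 q + q 0 ord_max)) <= tau.
Proof.
have [q_tau _] := q_sol; apply: le_trans q_tau.
set k := (_ + _)%N.
have k_lt : (k < n.+1)%N.
  by apply: leq_trans q_small; rewrite /k; case: (q _ _); lia.
have wmin j : sq_weight y ord_max <= sq_weight y j.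
  by apply: (sq_weight_sorted y_sorted); rewrite -ltnS ltn_ord.
(* The dimension is at least 3, so the first index can serve as the second index in
   [kappa_c_rmsnorm_le]. *)
have zero_max : ord0 != ord_max :> 'I_n.+1.
  by apply/eqP => /(congr1 val)/=; lia.
have norm0q := norm0_kept q.
apply: le_trans (kappa_c_rmsnorm_le y_neq0 _ zero_max wmin) _.
have [qn|qn] := boolP (q 0 ord_max); last first.
  (* Row [ord_max] of [q] has the same term 1 - 2 w as the bound for the leading ones, so only the
     kept weights remain to be compared, over equally many indices. *)
  apply: le_trans (kappa_c_rmsnorm_ge y_neq0 qn).
  rewrite !lerD2r.
  apply: (kept_weight_leading_ones y_sorted (k := Ordinal k_lt)).
  by apply: (@addnI (norm0 q)); rewrite /= /k (negbTE qn) addn0 norm0q subnKC//; lia.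
have /card_gt1P[i [j [iZ jZ ij]]] : (1 < #|kept q|)%N.
  by rewrite -(ltn_add2l (norm0 q)) norm0q; lia.
wlog wij : i j iZ jZ ij / sq_weight y i <= sq_weight y j.
  move=> H; have [/H|/ltW /H] := leP (sq_weight y i) (sq_weight y j); first exact.
  by apply; rewrite // eq_sym.
(* Of the two rows, that of the lighter index [i] gives the larger lower bound. *)
apply: le_trans (kappa_c_rmsnorm_ge (i := i) y_neq0 _); last by move: iZ; rewrite inE.
(* Replacing the two kept indices [i] and [j] by the last one, which [q] masks,
   yields as many indices as [leading_ones] keeps. *)
pose A := ord_max |: (kept q :\ i :\ j).
have nA : ord_max \notin kept q :\ i :\ j by rewrite !inE qn !andbF.
have kA : kept_weight y (leading_ones n.+1 k) <= \sum_(k in A) sq_weight y k.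
  apply: (kept_weight_leading_ones y_sorted (k := Ordinal k_lt)).
  move: norm0q; rewrite /= /k qn cardsU1 nA (cardsD1 i (kept q)) iZ.
  by rewrite (cardsD1 j (kept q :\ i)) in_setD1 eq_sym ij jZ; lia.
move: kA; rewrite big_setU1//= => kA.
have -> : kept_weight y q = sq_weight y i +
    (sq_weight y j + \sum_(k in kept q :\ i :\ j) sq_weight y k).
  rewrite /kept_weight (big_setD1 i)//= (big_setD1 j)//=.
  by rewrite in_setD1 eq_sym ij.
(* Once [kA] is inserted and common terms cancel, what remains is - w_max <= w_j - w_i, where w_max
   is the weight of [ord_max]. *)
have := wmin i; have : 0 <= sq_weight y ord_max by exact: sq_weight_ge0.
lra.
Qed.
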